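(* For every integer $n\ge 0$, \[ \overline{p}_o(n)=\sum_{k=-\infty}^{\infty}(-1)^{\lceil k/2\rceil}\,p\!\left(n-\frac{k(3k+1)}{2}\right). \]
   Context: $p(n)$ is the number of (unrestricted) partitions of $n$. $\overline{p}_o(n)$ denotes the number of overpartitions of $n$ into odd parts (partitions into odd parts in which the first occurrence of each part size may be overlined); $\sum_{n\ge0}\overline{p}_o(n)q^n=\frac{(-q;q^2)_\infty}{(q;q^2)_\infty}$, where $(a;q)_\infty=\prod_{k\ge1}(1-aq^{k-1})$. Convention: $p(x)=0$ whenever $x$ is not a nonnegative integer. *)

(* Defs.v *)
From mathcomp Require Import all_boot all_order all_algebra archimedean finmap.
From mathcomp Require Import zify lra.
From mathcomp Require Import boolp classical_sets functions cardinality fsbigop.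

Set Implicit Arguments.
Unset Strict Implicit.
Unset Printing Implicit Defensive.

Import Order.TTheory GRing.Theory Num.Theory.

(* A partition is a finite multiset of positive integers, given by its
   multiplicities: m i is the number of parts equal to i.+1. In a partition of
   n neither a part nor a multiplicity exceeds n. *)
Definition is_partition (n : nat) (m : {ffun 'I_n -> 'I_n.+1}) : bool :=
  \sum_(i < n) m i * i.+1 == n.

Definition part_sizes (n : nat) (m : {ffun 'I_n -> 'I_n.+1}) : {set 'I_n} :=
  [set i | 0 < m i].

Definition num_partitions (n : nat) : nat :=
  #|[set m : {ffun 'I_n -> 'I_n.+1} | is_partition m]|.

(* Only the first occurrence of a part size may be overlined, so an
   overpartition is a partition together with the set of the part sizes that
   are overlined. *)
Definition is_odd_overpartition (n : nat)
    (mo : {ffun 'I_n -> 'I_n.+1} * {set 'I_n}) : bool :=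
  [&& is_partition mo.1, [forall i in part_sizes mo.1, odd i.+1]
    & mo.2 \subset part_sizes mo.1].

Definition num_odd_overpartitions (n : nat) : nat :=
  #|[set mo : {ffun 'I_n -> 'I_n.+1} * {set 'I_n} | is_odd_overpartition mo]|.

Local Open Scope ring_scope.

Definition num_partitions_rat (x : rat) : nat :=
  if x \is a Num.nat then num_partitions (Num.truncn x) else 0%N.

(* \sum_(k \in A) F k is 0 by convention when F has infinite support on A;
   this lemma rules that out for the sum over all k : int. *)
Lemma pentagonal_finite_support (n : nat) :
  finite_set [set k : int | num_partitions_rat
    (n%:R - k%:~R * (3 * k%:~R + 1) / 2) != 0%N]%classic.
Proof.
apply: (@sub_finite_set _ _ ((fun i : nat => i%:Z - n%:Z) @` `I_(n + n).+1)%classic);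
  last exact: finite_image (finite_II _).
move=> k /=; rewrite /num_partitions_rat; case: ifP => // /natr_ge0 hx _.
have {hx} : 0 <= n%:Z + n%:Z - k * (3 * k + 1).
  rewrite -(ler0z rat) rmorphB rmorphM rmorphD rmorphD rmorphM /=.
  by rewrite -[n%:~R]/(n%:R); lra.
move=> hx; exists (absz (k + n%:Z)) => /=; nia.
Qed.

(* Main.v *)
Require Import Defs.
From mathcomp Require Import all_boot all_order all_algebra archimedean finmap.
From mathcomp Require Import zify ring lra.
From mathcomp Require Import boolp classical_sets functions cardinality fsbigop.

(** Modulo [X^(n+1)], write [P], [O] for the generating functions of partitions
    and of odd overpartitions. Then [P * \prod_i (1 - X^i) = 1] and
    [O * \prod_(i odd) (1 - X^i) = \prod_(i odd) (1 + X^i)]; multiplying the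
    latter by [P * \prod_(i even) (1 - X^i)] gives
    [O = P * \prod_i (1 - (-X)^i)]. The last product is expanded by Euler's
    pentagonal number theorem at [-X], which is read off Shanks' finite identity
    [\sum_(|k| <= n) (-1)^k x^(k(3k+1)/2)
       = \sum_(s <= n) (-1)^s (\prod_(s < i <= n) (1 - x^i)) x^(sn + s(s+1)/2)],
    all of whose terms with [s > 0] are divisible by [x^(n+1)]. *)

Set Implicit Arguments.
Unset Strict Implicit.
Unset Printing Implicit Defensive.

Import Order.TTheory GRing.Theory Num.Theory.

Local Open Scope ring_scope.

(** * Shanks' identity *)

Section Shanks.
Variables (R : comPzRingType) (x : R).

Definition shanks_term (n s : nat) : R :=
  (-1) ^+ s * (\prod_(s <= i < n) (1 - x ^+ i.+1)) * x ^+ (s * n + 'C(s.+1, 2)).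

(** The terms of index [-k] and [k] of the pentagonal series are paired:
    [k(3k-1)/2 = k^2 + 'C(k, 2)] and [k(3k+1)/2 = k^2 + 'C(k+1, 2)]. The binomials avoid division in
    [nat]. *)
Definition pentagonal_sum (n : nat) : R :=
  1 + \sum_(0 <= k < n) (-1) ^+ k.+1 *
        (x ^+ (k.+1 * k.+1 + 'C(k.+1, 2)) + x ^+ (k.+1 * k.+1 + 'C(k.+2, 2))).

(* [G] is the certificate that makes the step from [n] to [n.+1] telescope. *)
Lemma shanks_termB (n s : nat) : (s <= n)%N ->
  let G s := if s is t.+1 then
    (-1) ^+ s * (\prod_(t <= i < n) (1 - x ^+ i.+1)) * x ^+ (s * n.+1 + 'C(s, 2))
    else 0 in
  shanks_term n.+1 s - shanks_term n s = G s.+1 - G s.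
Proof.
move=> le_sn /=; rewrite /shanks_term big_nat_recr //=.
case: s le_sn => [|t] lt_tn.
  by rewrite !mul0n !mul1n !add0n addn0 !bin_small // expr0 expr1; ring.
rewrite [in X in _ = _ - X](big_ltn lt_tn) binS bin1.
set B := 'C(t.+1, 2); set Q := \prod_(t.+1 <= i < n) _.
(* Every exponent becomes [t.+1 * n + B] plus copies of [t.+1] and [n.+1], which leaves a polynomial
   identity in three powers of [x]. *)
have -> : (t.+1 * n.+1 + (B + t.+1) = t.+1 * n + B + t.+1 + t.+1)%N by lia.
have -> : (t.+1 * n + (B + t.+1) = t.+1 * n + B + t.+1)%N by lia.
have -> : (t.+2 * n.+1 + (B + t.+1) = t.+1 * n + B + t.+1 + t.+1 + n.+1)%N by lia.
have -> : (t.+1 * n.+1 + B = t.+1 * n + B + t.+1)%N by lia.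
rewrite !(exprD _ (_ + t.+1)) [(-1) ^+ t.+2]exprS.
by rewrite !(exprD _ (t.+1 * n + B)); ring.
Qed.

(** By induction on [n]: the increments of the terms [s <= n] telescope to the first new monomial of
    [pentagonal_sum], and the new term [s = n.+1] is the second. *)
Lemma shanks_identity (n : nat) :
  \sum_(0 <= s < n.+1) shanks_term n s = pentagonal_sum n.
Proof.
rewrite /pentagonal_sum; elim: n => [|n IHn].
  by rewrite big_nat1 big_nil /shanks_term big_nil !mul1r expr0 addr0.
rewrite [in RHS]big_nat_recr //= addrA -IHn big_nat_recr //=.
have /(congr1 (fun t => t + \sum_(0 <= s < n.+1) shanks_term n s)) :
    \sum_(0 <= s < n.+1) (shanks_term n.+1 s - shanks_term n s) =
    (-1) ^+ n.+1 * x ^+ (n.+1 * n.+1 + 'C(n.+1, 2)).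
  under eq_big_nat => s /andP[_ le_sn] do rewrite shanks_termB //.
  by rewrite telescope_sumr //= big_geq // mulr1 subr0.
rewrite sumrB subrK => ->; rewrite /shanks_term big_geq //; ring.
Qed.

End Shanks.

(** * Polynomials modulo a power of the variable *)

Section EqModXn.
Variables (R : comNzRingType) (N : nat).
Implicit Types p q r : {poly R}.

Definition eqmodXn p q := forall i, (i < N)%N -> p`_i = q`_i.

Lemma eqmodXnM p1 q1 p2 q2 :
  eqmodXn p1 q1 -> eqmodXn p2 q2 -> eqmodXn (p1 * p2) (q1 * q2).
Proof.
move=> e1 e2 i lt_iN; rewrite !coefM; apply: eq_bigr => j _.
by rewrite e1 ?e2 //; apply: leq_ltn_trans lt_iN; rewrite ?leq_subr // -ltnS.
Qed.

Lemma eqmodXn_prod (I : Type) (r : seq I) (P : pred I) (F G : I -> {poly R}) :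
  (forall i, P i -> eqmodXn (F i) (G i)) ->
  eqmodXn (\prod_(i <- r | P i) F i) (\prod_(i <- r | P i) G i).
Proof. by move=> eFG; apply: (big_ind2 eqmodXn) => //; exact: eqmodXnM. Qed.

Lemma eqmodXn_prod1 (I : Type) (r : seq I) (P : pred I) (F : I -> {poly R}) :
  (forall i, P i -> eqmodXn (F i) 1) -> eqmodXn (\prod_(i <- r | P i) F i) 1.
Proof.
move=> eF1; apply: (big_ind (eqmodXn ^~ 1)) => // p q p1 q1.
by rewrite -[X in eqmodXn _ X]mulr1; exact: eqmodXnM.
Qed.

Lemma eqmodXn_addXnM p q k : (N <= k)%N -> eqmodXn (p + 'X^k * q) p.
Proof.
by move=> le_Nk i lt_iN; rewrite coefD coefXnM (leq_trans lt_iN le_Nk) addr0.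
Qed.

End EqModXn.

Lemma pentagonal_sum_eqmodXn (n : nat) :
  eqmodXn n.+1 (pentagonal_sum (- 'X : {poly int}) n)
               (\prod_(0 <= i < n) (1 - (- 'X) ^+ i.+1)).
Proof.
rewrite -shanks_identity [X in eqmodXn _ X _]big_ltn // => i lt_in.
rewrite coefD {1}/shanks_term mul0n add0n bin_small // !expr0 mul1r mulr1.
rewrite coef_sum [X in _ + X]big_nat [X in _ + X]big1 ?addr0 // => s /andP[s_gt0 _].
rewrite /shanks_term (exprNn 'X) mulrA coefMXn.
by rewrite (leq_trans lt_in) //; case: s s_gt0 => // s _; rewrite binS bin1; nia.
Qed.

(** * Generating functions *)

Definition geom_poly (n i : nat) : {poly int} := \sum_(j < n.+1) 'X^(j * i.+1).

Definition part_poly (n : nat) : {poly int} := \prod_(i < n) geom_poly n i.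

(** Counts the ways to overline the size [i.+1] when it occurs [j] times; the weight 0 excludes even
    parts. *)
Definition odd_overpart_coef (i j : nat) : int :=
  if j == 0%N then 1 else if odd i.+1 then 2 else 0.

Definition odd_overpart_poly (n : nat) : {poly int} :=
  \prod_(i < n) \sum_(j < n.+1) odd_overpart_coef i j *: 'X^(j * i.+1).

(** Expanding the product chooses a multiplicity for each part size, and the resulting monomial is
    ['X^n] exactly when the choice is a partition of [n]. *)
Lemma coef_prod_weighted (n : nat) (c : nat -> nat -> int) :
  (\prod_(i < n) \sum_(j < n.+1) c i j *: 'X^(j * i.+1))`_n =
  \sum_(m : {ffun 'I_n -> 'I_n.+1} | is_partition m) \prod_(i < n) c i (m i).
Proof.
rewrite bigA_distr_bigA coef_sum [RHS]big_mkcond /=; apply: eq_bigr => m _.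
rewrite scaler_prod -expr_sum coefZ coefXn eq_sym -/(is_partition m).
by case: ifP; rewrite ?mulr1 ?mulr0.
Qed.

Lemma coef_part_poly (n : nat) : (part_poly n)`_n = (num_partitions n)%:Z.
Proof.
have -> : part_poly n =
    \prod_(i < n) \sum_(j < n.+1) (1 : int) *: 'X^(j * i.+1).
  by apply: eq_bigr => i _; apply: eq_bigr => j _; rewrite scale1r.
rewrite (coef_prod_weighted n (fun _ _ => 1)) /num_partitions.
under eq_bigr do rewrite big1 //.
by rewrite sumr_const cardsE natz.
Qed.

Lemma coef_odd_overpart_poly (n : nat) :
  (odd_overpart_poly n)`_n = (num_odd_overpartitions n)%:Z.
Proof.
rewrite coef_prod_weighted /num_odd_overpartitions -sum1dep_card.
rewrite (eq_bigl (fun mo : {ffun 'I_n -> 'I_n.+1} * {set 'I_n} =>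
    (is_partition mo.1 && [forall i in part_sizes mo.1, odd i.+1])
    && (mo.2 \subset part_sizes mo.1))); last by move=> mo; rewrite -andbA.
rewrite -(pair_big_dep (fun m : {ffun 'I_n -> 'I_n.+1} =>
    is_partition m && [forall i in part_sizes m, odd i.+1])
  (fun m (A : {set 'I_n}) => A \subset part_sizes m) (fun _ _ => 1%N)) /=.
rewrite -natz natr_sum big_mkcondr; apply: eq_bigr => m _.
case: ifPn => [/forall_inP odd_m | /forall_inPn[i]].
  (* The overlinings of [m] are the subsets of [part_sizes m]: each size present contributes a
     factor 2, each absent one a factor 1. *)
  rewrite sum1dep_card -/(powerset _) card_powerset natrX.
  rewrite (bigID (mem (part_sizes m))) /= [X in _ * X]big1 ?mulr1.
    rewrite -prodr_const; apply: eq_bigr => i m_i.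
    rewrite /odd_overpart_coef /= (odd_m i m_i).
    by move: m_i; rewrite inE lt0n => /negbTE ->.
  by move=> i; rewrite inE /odd_overpart_coef lt0n negbK => ->.
(* An even part makes its factor, hence the whole product, vanish. *)
rewrite inE => m_gt0 odd_i; rewrite (bigD1 i) //= /odd_overpart_coef.
by rewrite /= eqn0Ngt m_gt0 (negbTE odd_i) mul0r.
Qed.

Lemma geom_polyM (n i : nat) :
  (1 - 'X^(i.+1)) * geom_poly n i = 1 - 'X^(n.+1 * i.+1).
Proof.
apply: oppr_inj; rewrite -mulNr !opprB mulnC exprM (subrX1 'X^(i.+1)); congr (_ * _).
by apply: eq_bigr => j _; rewrite mulnC exprM.
Qed.

Lemma geom_polyM_eqmodXn (n i : nat) :
  eqmodXn n.+1 ((1 - 'X^(i.+1)) * geom_poly n i) 1.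
Proof.
rewrite geom_polyM -mulrN1; apply: eqmodXn_addXnM; exact: leq_pmulr.
Qed.

Lemma part_polyM_eqmodXn (n : nat) :
  eqmodXn n.+1 ((\prod_(i < n) (1 - 'X^(i.+1))) * part_poly n) 1.
Proof.
rewrite -big_split /=.
by apply: eqmodXn_prod1 => i _; exact: geom_polyM_eqmodXn.
Qed.

Lemma odd_overpart_factor (n i : nat) :
  \sum_(j < n.+1) odd_overpart_coef i j *: 'X^(j * i.+1) =
  if odd i.+1 then geom_poly n i *+ 2 - 1 else 1.
Proof.
rewrite /geom_poly !big_ord_recl /= mul0n expr0 scale1r.
case: ifPn => odd_i; last first.
  rewrite big1 ?addr0 // => j _.
  by rewrite /odd_overpart_coef /= (negbTE odd_i) scale0r.
set S := (X in _ = (1 + X) *+ 2 - 1).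
have -> : (1 + S) *+ 2 - 1 = 1 + S *+ 2 by ring.
rewrite -sumrMnl; congr (_ + _).
apply: eq_bigr => j _; rewrite /odd_overpart_coef /= odd_i.
by rewrite scaler_nat.
Qed.

(** Factor by factor: for [i.+1] odd, [(1 - X^(i+1))(2 geom_poly - 1)] is [1 + X^(i+1)] up to a
    multiple of [X^((n+1)(i+1))]; for [i.+1] even the factor [1 - X^(i+1)] is unchanged. Both are
    [1 - (-X)^(i+1)]. *)
Lemma odd_overpart_polyM_eqmodXn (n : nat) :
  eqmodXn n.+1 ((\prod_(i < n) (1 - 'X^(i.+1))) * odd_overpart_poly n)
               (\prod_(0 <= i < n) (1 - (- 'X) ^+ i.+1)).
Proof.
rewrite -big_split big_mkord /=; apply: eqmodXn_prod => i _.
rewrite odd_overpart_factor exprNn -signr_odd; case: ifPn => odd_i.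
  rewrite mulrBr mulrnAr mulr1 geom_polyM.
  have -> : 1 - (-1) ^+ true * 'X^(i.+1) = 1 + 'X^(i.+1) :> {poly int} by ring.
  have -> : (1 - 'X^(n.+1 * i.+1)) *+ 2 - (1 - 'X^(i.+1)) =
    1 + 'X^(i.+1) + 'X^(n.+1 * i.+1) * (- 2%:R) :> {poly int} by ring.
  by apply: eqmodXn_addXnM; exact: leq_pmulr.
by rewrite expr0 mul1r mulr1.
Qed.

(** [coef_part_poly] reads only the coefficient of index [n], whereas the product with the
    pentagonal sum involves all lower ones. Modulo [X^(m+1)], [part_poly n] and [part_poly m] invert
    the same product [E], so they agree by uniqueness of inverses. *)
Lemma coef_part_poly_le (n m : nat) : (m <= n)%N ->
  (part_poly n)`_m = (num_partitions m)%:Z.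
Proof.
move=> le_mn; rewrite -coef_part_poly.
have eqE : eqmodXn m.+1 (\prod_(i < n) (1 - 'X^(i.+1)))
                        (\prod_(i < m) (1 - 'X^(i.+1)) : {poly int}).
  rewrite -!(big_mkord predT (fun i => 1 - 'X^(i.+1))).
  rewrite (big_cat_nat (leq0n m) le_mn) /=.
  rewrite -[X in eqmodXn _ _ X]mulr1; apply: eqmodXnM => //.
  rewrite big_nat; apply: eqmodXn_prod1 => i => /andP[le_mi _].
  by rewrite -mulrN1; exact: eqmodXn_addXnM.
set E := \prod_(i < m) _ in eqE.
have EG i : (i < m.+1)%N ->
    (\prod_(j < n) (1 - 'X^(j.+1)) * part_poly n)`_i = (1 : {poly int})`_i.
  by move=> lt_im; rewrite part_polyM_eqmodXn // (leq_trans lt_im).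
have e1 : eqmodXn m.+1 (part_poly n) (part_poly n * (E * part_poly m)).
  rewrite -[X in eqmodXn _ X _]mulr1; apply: eqmodXnM => // i lt_im.
  by rewrite part_polyM_eqmodXn.
rewrite e1 // mulrA [part_poly n * E]mulrC.
rewrite -[in RHS](mul1r (part_poly m)).
apply: (@eqmodXnM _ m.+1) => // i lt_im.
by rewrite -EG //; apply: (@eqmodXnM _ m.+1) => // j lt_jm; rewrite eqE.
Qed.

Lemma odd_overpart_poly_eqmodXn (n : nat) :
  eqmodXn n.+1 (odd_overpart_poly n) (pentagonal_sum (- 'X) n * part_poly n).
Proof.
set E : {poly int} := \prod_(i < n) (1 - 'X^(i.+1)).
move=> i lt_in; transitivity ((E * odd_overpart_poly n * part_poly n)`_i).
  rewrite mulrAC -[in LHS](mul1r (odd_overpart_poly n)).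
  by apply: eqmodXnM lt_in => // j lt_jn; rewrite part_polyM_eqmodXn.
apply: eqmodXnM lt_in => // j lt_jn.
by rewrite odd_overpart_polyM_eqmodXn // pentagonal_sum_eqmodXn.
Qed.

(** * The sum over all integers *)

Lemma odd_bin2 (m : nat) : odd 'C(m, 2) = odd m./2.
Proof.
(* Passing from [m] to [m + 2] adds [2m + 1] to the binomial and 1 to the half, flipping both
   parities; hence the induction on two consecutive values. *)
suff: odd 'C(m, 2) = odd m./2 /\ odd 'C(m.+1, 2) = odd m.+1./2 by case.
elim: m => [|m [IH1 IH2]] //; split=> //.
rewrite binS bin1 binS bin1 !oddD IH1 /=.
by case: (odd m); case: (odd m./2).
Qed.

Lemma num_partitions_rat_natB (n a : nat) :
  num_partitions_rat (n%:R - a%:R) =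
  if (n < a)%N then 0%N else num_partitions (n - a).
Proof.
rewrite /num_partitions_rat; case: ltnP => [lt_na | le_an].
  by case: ifP => // /natr_ge0; rewrite subr_ge0 ler_nat leqNgt lt_na.
by rewrite -natrB // natr_nat natrK.
Qed.

Lemma fsbig_int_symmetric (n : nat) (F : int -> int) :
  (forall k : int, (n < `|k|)%N -> F k = 0) ->
  \sum_(k \in [set: int]%classic) F k =
  F 0 + \sum_(0 <= k < n) (F (- k.+1%:Z) + F k.+1%:Z).
Proof.
move=> F0.
(* A repetition-free list of the integers of absolute value at most [n], ordered so that its two
   tails pair up [-k] with [k]. *)
pose r : seq int :=
  0 :: [seq - k.+1%:Z | k <- iota 0 n] ++ [seq k.+1%:Z | k <- iota 0 n].
have uniq_r : uniq r.
  have inj_pos : injective (fun k => k.+1%:Z) by move=> i j [].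
  have inj_neg : injective (fun k => - k.+1%:Z) by move=> i j /oppr_inj [].
  rewrite /= mem_cat cat_uniq negb_or.
  rewrite (map_inj_uniq inj_pos) (map_inj_uniq inj_neg).
  rewrite iota_uniq andbT -andbA; apply/and3P; split.
  - by apply/mapP => -[k _]; lia.
  - by apply/mapP => -[k _]; lia.
  - by apply/hasPn => x /mapP[k _ ->]; apply/mapP => -[j _]; lia.
have sub_r : ([set` r] `<=` [set: int])%classic by [].
rewrite -(fsbig_widen _ _ _ sub_r) => [|k [_ /= /negP k_r]]; last first.
  apply: F0; rewrite ltnNge; apply: contra k_r => le_kn.
  rewrite inE mem_cat; apply/or3P.
  case: (ltrgt0P k) => k0; [apply: Or33 | apply: Or32 | by apply: Or31].
  - by apply/mapP; exists `|k|.-1%N; rewrite ?mem_iota; lia.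
  - by apply/mapP; exists `|k|.-1%N; rewrite ?mem_iota; lia.
rewrite -fsbig_seq // big_cons big_cat !big_map /= -big_split /=.
by rewrite /index_iota subn0.
Qed.

Lemma ceil_half (k : nat) : Num.ceil (k%:R / 2 : rat) = (uphalf k)%:Z.
Proof.
apply/ceil_def; rewrite intrB uphalf_half.
rewrite -[in X in _ < X <= _](odd_double_half k) -addnn.
rewrite -!pmulrn !natrD; case: (odd k) => /=; lra.
Qed.

Lemma ceil_Nhalf (k : nat) : Num.ceil (- (k%:R / 2) : rat) = - (k./2)%:Z.
Proof.
rewrite ceilNfloor opprK; congr (- _); apply/floor_def.
rewrite intrD -[in X in _ <= X < _](odd_double_half k) -addnn.
rewrite -!pmulrn !natrD; case: (odd k) => /=; lra.
Qed.

Definition pentagonal_term (n : nat) (k : int) : int :=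
  (-1) ^ Num.ceil (k%:~R / 2 : rat)
    * (num_partitions_rat (n%:R - k%:~R * (3 * k%:~R + 1) / 2))%:Z.

Lemma bin2_rat (k : nat) : ('C(k, 2))%:R = k%:R * (k%:R - 1) / 2 :> rat.
Proof.
elim: k => [|k IHk]; first by rewrite !mul0r.
by rewrite binS bin1 natrD IHk -natr1; field.
Qed.

(** Only the parity of the total exponent of [-1] matters, so [e] can later be the ceiling in the
    theorem. When [a > n] both sides vanish. *)
Lemma coef_signed_XnM (n a k e : nat) : odd (k + a) = odd e ->
  ((-1) ^+ k * (- 'X) ^+ a * part_poly n)`_n =
  (-1) ^+ e * (num_partitions_rat (n%:R - a%:R))%:Z.
Proof.
move=> odd_e; rewrite (exprNn 'X) mulrA -exprD -signr_odd odd_e signr_odd.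
rewrite -mulrA -(rmorph_sign polyC) mul_polyC coefZ coefXnM num_partitions_rat_natB.
by case: ltnP => // _; rewrite coef_part_poly_le // leq_subr.
Qed.

(** Since [k + k^2] is even, the sign is governed by ['C(k+1, 2)], whose parity is that of
    [uphalf k], the ceiling of [k/2]. *)
Lemma pentagonal_term_pos (n k : nat) :
  pentagonal_term n k%:Z =
  ((-1) ^+ k * (- 'X) ^+ (k * k + 'C(k.+1, 2)) * part_poly n)`_n.
Proof.
rewrite (@coef_signed_XnM _ _ _ (uphalf k)); last first.
  by rewrite oddD oddD oddM odd_bin2 andbb addbA addbb uphalfE.
rewrite /pentagonal_term -!pmulrn ceil_half natrD natrM bin2_rat -natr1.
by congr (_ * (num_partitions_rat _)%:Z); field.
Qed.

(** Here the sign is governed by ['C(k, 2)], with the parity of [k./2]; the ceiling of [-k/2] is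
    [- k./2], and negating an exponent of [-1] changes nothing. *)
Lemma pentagonal_term_neg (n k : nat) :
  pentagonal_term n (- k%:Z) =
  ((-1) ^+ k * (- 'X) ^+ (k * k + 'C(k, 2)) * part_poly n)`_n.
Proof.
rewrite (@coef_signed_XnM _ _ _ k./2); last first.
  by rewrite oddD oddD oddM odd_bin2 andbb addbA addbb.
rewrite /pentagonal_term mulrNz -!pmulrn mulNr ceil_Nhalf natrD natrM bin2_rat.
congr (_ * (num_partitions_rat _)%:Z); last by field.
by rewrite -exprz_inv invrN1.
Qed.

Theorem theorem3p3 (n : nat) :
  (num_odd_overpartitions n)%:Z =
  \sum_(k \in [set: int]%classic)
    (-1) ^ Num.ceil (k%:~R / 2 : rat)
    * (num_partitions_rat (n%:R - k%:~R * (3 * k%:~R + 1) / 2))%:Z.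
Proof.
rewrite -coef_odd_overpart_poly odd_overpart_poly_eqmodXn //.
rewrite (@fsbig_int_symmetric n (pentagonal_term n)) => [|k lt_nk]; last first.
  (* Outside [[-n, n]] the pentagonal exponent is at least [m * m > n], so the partition count is 0
     whatever the sign. *)
  have {lt_nk} [m lt_nm [->|->]] : exists2 m, (n < m)%N & k = m%:Z \/ k = - m%:Z.
    by exists `|k|%N => //; lia.
  - rewrite pentagonal_term_pos (coef_signed_XnM _ erefl).
    by rewrite num_partitions_rat_natB ifT ?mulr0 //; nia.
  - rewrite pentagonal_term_neg (coef_signed_XnM _ erefl).
    by rewrite num_partitions_rat_natB ifT ?mulr0 //; nia.
rewrite /pentagonal_sum mulrDl coefD; congr (_ + _).
  by rewrite (pentagonal_term_pos n 0) !expr0 mulr1.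
rewrite mulr_suml coef_sum; apply: eq_bigr => k _.
by rewrite pentagonal_term_neg pentagonal_term_pos mulrDr mulrDl coefD.
Qed.
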